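(* For the path $P_n$ on $n$ vertices, $$\tau_{K_3}(P_n)=1 \iff n\ge 6.$$
   Context: All graphs are finite and simple. A matching is a set of pairwise vertex-disjoint edges; $V(M)$ denotes the set of endpoints of the edges of $M$. Degree-preserving Builder--Chooser game started from a graph $G_0$: it is played in rounds $t=1,2,\dots$. In round $t$ the current graph is $G_{t-1}=(V,E)$. (i) Builder chooses a matching $M\subseteq E$ and forms the intermediate graph $G^+$ by deleting the edges of $M$, adding a new vertex $w$, and joining $w$ to every vertex of $V(M)$ (a DPG step). (ii) Builder chooses a partition of $E(G^+)$ into two disjoint sets $E^{(0)}\sqcup E^{(1)}$. (iii) Chooser selects $i\in\{0,1\}$, and $G_t:=(V(G^+),E^{(i)})$. For graphs $H$ and $G_0$, the forcing time $\tau_H(G_0)$ is the least $T\ge 0$ such that Builder has a strategy in the game started from $G_0$ guaranteeing that $G_t$ contains $H$ as a (not necessarily induced) subgraph for some $0\le t\le T$; $\tau_H(G_0)=\infty$ if there is no such $T$, i.e. if Chooser can avoid $H$ forever. *)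

(* Defs.v *)
From mathcomp Require Import all_boot.
From mathcomp Require Import boolp.

Set Implicit Arguments.
Unset Strict Implicit.
Unset Printing Implicit Defensive.

Record sgraph := SGraph {
  vertex :> finType;
  edges : {set {set vertex}};
  edges_card2 : [forall e in edges, #|e| == 2] }.

Lemma edgeP (G : sgraph) (e : {set G}) : e \in edges G -> #|e| = 2.
Proof. by move=> eG; apply/eqP; exact: (forall_inP (edges_card2 G)). Qed.

(* Not necessarily induced subgraph, up to isomorphism. *)
Definition contains (G H : sgraph) : Prop :=
  exists2 f : H -> G, injective f &
    forall e : {set H}, e \in edges H -> f @: e \in edges G.

Lemma complete_card2 n :
  [forall e in [set e : {set 'I_n} | #|e| == 2], #|e| == 2].
Proof. by apply/forall_inP => e; rewrite inE. Qed.

Definition complete_graph (n : nat) : sgraph := SGraph (complete_card2 n).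

Definition path_edges (n : nat) : {set {set 'I_n}} :=
  [set e | [exists i : 'I_n, exists j : 'I_n,
              (j == i.+1 :> nat) && (e == [set i; j])]].

Lemma path_card2 n : [forall e in path_edges n, #|e| == 2].
Proof.
apply/forall_inP => e; rewrite inE.
move=> /existsP[i /existsP[j /andP[/eqP ij /eqP ->]]].
by rewrite cards2 -val_eqE /= ij neq_ltn ltnSn.
Qed.

Definition path_graph (n : nat) : sgraph := SGraph (path_card2 n).

Section Game.

Variable G : sgraph.
Implicit Types M : {set {set G}}.

(* [cover M], the union of the edges in M, is the set V(M). *)
Definition matching M : bool := (M \subset edges G) && trivIset M.

(* The new vertex w is [None]; the old vertex x becomes [Some x]. *)
Definition dpg_edges M : {set {set option G}} :=
  [set Some @: (e : {set G}) | e in edges G :\: M]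
    :|: [set [set None; Some x] | x in cover M].

Lemma dpg_card2 M : [forall e in dpg_edges M, #|e| == 2].
Proof.
apply/forall_inP => e; rewrite inE => /orP[] /imsetP[x xP ->].
  move: xP; rewrite inE => /andP[_ /edgeP xG].
  by rewrite card_imset ?xG //; exact: Some_inj.
by rewrite cards2.
Qed.

Definition dpg_step M : sgraph := SGraph (dpg_card2 M).

Record builder_move := BuilderMove {
  mv_matching : {set {set G}};
  mv_part : bool -> {set {set dpg_step mv_matching}};
  mv_matchingP : matching mv_matching;
  mv_cover : mv_part false :|: mv_part true = edges (dpg_step mv_matching);
  mv_disjoint : [disjoint mv_part false & mv_part true] }.

Lemma mv_card2 (m : builder_move) (i : bool) :
  [forall e in mv_part m i, #|e| == 2].
Proof.
apply/forall_inP => e em; apply/eqP/edgeP; rewrite -mv_cover inE.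
by case: i em => ->; rewrite ?orbT.
Qed.

Definition next_graph (m : builder_move) (i : bool) : sgraph :=
  SGraph (mv_card2 m i).

End Game.

(* Given the strategy and the initial graph, the earlier choices of Chooser,
   listed here in chronological order, determine the whole history. *)
Definition strategy : Type := seq bool -> forall G : sgraph, builder_move G.

(* [play s G0 c t] is the graph G_t when Chooser selects [c t] in the
   (t + 1)-st round. As [s] is deterministic, quantifying over all sequences
   [c] amounts to quantifying over all behaviours of Chooser. *)
Fixpoint play (s : strategy) (G0 : sgraph) (c : nat -> bool) (t : nat)
    : sgraph :=
  if t is t'.+1 then
    next_graph (s (mkseq c t') (play s G0 c t')) (c t')
  else G0.

Definition forces (H G0 : sgraph) (T : nat) : Prop :=
  exists s : strategy, forall c : nat -> bool,
    exists2 t, t <= T & contains (play s G0 c t) H.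

(* [None] stands for infinity. *)
Definition forcing_time (H G0 : sgraph) : option nat :=
  if pselect (exists T, `[< forces H G0 T >]) is left exT
  then Some (ex_minn exT) else None.

(* Main.v *)
(** Deleting a matching from a path leaves a forest, so every triangle of the
    graph after a DPG step consists of the new vertex and an edge of the path
    that is not in the matching but has both endpoints covered by it. Builder
    wins in one round iff there are two such triangles without common edge,
    that is, two vertex-disjoint path edges {p, p+1} and {q, q+1} with p < q.
    Then p is covered by {p-1, p} and q+1 by {q+1, q+2}, which takes at least
    six vertices; conversely the matching {01, 23, 45} gives the path edges 12
    and 34. *)

Require Import Defs.
From mathcomp Require Import all_boot.
From mathcomp Require Import boolp zify.

Set Implicit Arguments.
Unset Strict Implicit.
Unset Printing Implicit Defensive.

(** Distinctness of the vertices is left to [edge_neq]: when [F] consists of two-element sets, the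
    three memberships force it. *)
Definition triangle (T : finType) (F : {set {set T}}) (x y z : T) : bool :=
  [&& [set x; y] \in F, [set y; z] \in F & [set x; z] \in F].

Lemma edge_neq (G : sgraph) (x y : G) : [set x; y] \in edges G -> x != y.
Proof. by move/edgeP; rewrite cards2; case: (x == y). Qed.

Lemma contains_K3P (G : sgraph) :
  contains G (complete_graph 3) <-> exists x y z, triangle (edges G) x y z.
Proof.
split=> [[f _ fE]|[x [y [z /and3P[xy yz xz]]]]].
  pose i0 : 'I_3 := inord 0; pose i1 : 'I_3 := inord 1.
  pose i2 : 'I_3 := inord 2.
  have fE2 (i j : 'I_3) : i != j -> [set f i; f j] \in edges G.
    move=> ij; have -> : [set f i; f j] = f @: [set i; j].
      by rewrite imsetU1 imset_set1.
    by apply: fE; rewrite inE cards2 ij.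
  exists (f i0), (f i1), (f i2).
  by rewrite /triangle !fE2 // -val_eqE /= !inordK.
pose s := [:: x; y; z]; pose f (i : 'I_3) := nth x s i.
have us : uniq s by rewrite /= !inE negb_or !(edge_neq xy, edge_neq yz, edge_neq xz).
exists f => [i j /eqP|e].
  by rewrite nth_uniq // => /eqP/val_inj.
rewrite [edges (complete_graph 3)]/= inE => /cards2P[i [j [ij ->]]].
rewrite imsetU1 imset_set1 /f.
case: i j ij => [[|[|[|//]]] ?] [[|[|[|//]]] ?] //= _;
  by rewrite // setUC.
Qed.

Lemma path_edgeE n (a b : 'I_n) :
  ([set a; b] \in path_edges n) = (b == a.+1 :> nat) || (a == b.+1 :> nat).
Proof.
rewrite inE; apply/existsP/idP => [[i /existsP[j /andP[/eqP ij /eqP eij]]]|].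
  move/setP: eij => eij; have := eij a; have := eij b.
  have := eij i; have := eij j; rewrite !inE -!val_eqE /=; lia.
case/orP=> h; first by exists a; apply/existsP; exists b; rewrite h /=.
by exists b; apply/existsP; exists a; rewrite h /= setUC.
Qed.

(** Adjacent vertices differ by exactly 1, and three integers cannot pairwise do so. *)
Lemma path_K3_free n : ~ contains (path_graph n) (complete_graph 3).
Proof.
move/contains_K3P => [x [y [z]]]; rewrite /triangle /= !path_edgeE; lia.
Qed.

Section DpgStep.

Variables (G : sgraph) (M : {set {set G}}).

Lemma dpg_edge_old (a b : G) :
  ([set Some a; Some b] \in dpg_edges M) = ([set a; b] \in edges G :\: M).
Proof.
have -> : [set Some a; Some b] = Some @: [set a; b] by rewrite imsetU1 imset_set1.
rewrite in_setU mem_imset; last exact/imset_inj/Some_inj.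
case: (_ \in _) => //=; apply/negP => /imsetP[x _].
by move/setP/(_ None); rewrite !inE eqxx; case/imsetP.
Qed.

Lemma dpg_edge_new (a : G) :
  ([set None; Some a] \in dpg_edges M) = (a \in cover M).
Proof.
rewrite in_setU; apply/orP/idP => [[]/imsetP[e eM]|aM].
- by move/setP/(_ None); rewrite !inE eqxx => /esym/imsetP[].
- by move/setP/(_ (Some a)); rewrite !inE eqxx /= => /esym/eqP[->].
by right; apply/imsetP; exists a.
Qed.

(** A triangle on old vertices only would already be one in [G], so [None] is a corner and can be
    listed first. The set [F] stands for either part of Builder's partition. *)
Lemma dpg_triangle (F : {set {set option G}}) :
    ~ contains G (complete_graph 3) -> F \subset dpg_edges M ->
    (exists x y z, triangle F x y z) ->
  exists a b, triangle F None (Some a) (Some b).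
Proof.
move=> G3 /subsetP sF [x [y [z /and3P[xy yz xz]]]].
have FE u v : [set u; v] \in F -> u != v.
  by move/sF/(@edge_neq (dpg_step M)).
have uv := FE _ _ xy; have vw := FE _ _ yz; have uw := FE _ _ xz.
case: x y z xy yz xz uv vw uw => [x|] [y|] [z|] // xy yz xz _ _ _.
- case: G3; apply/contains_K3P; exists x, y, z.
  move: xy yz xz => /sF + /sF + /sF.
  by rewrite !dpg_edge_old !inE /triangle => /andP[_ ->] /andP[_ ->] /andP[_ ->].
- by exists x, y; rewrite /triangle xy ![[set None; _]]setUC yz xz.
- by exists x, z; rewrite /triangle yz xz setUC xy.
by exists y, z; rewrite /triangle xy yz xz.
Qed.

End DpgStep.

Section SplitMove.

Variables (G : sgraph) (M : {set {set G}}) (F : {set {set option G}}).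
Hypotheses (matM : matching M) (sF : F \subset dpg_edges M).

Let part (i : bool) : {set {set dpg_step M}} :=
  if i then F else dpg_edges M :\: F.

Let part_cover : part false :|: part true = edges (dpg_step M).
Proof. by rewrite setUC /= setDE setUIr setUCr setIT; apply/setUidPr. Qed.

Let part_disjoint : [disjoint part false & part true].
Proof. by rewrite -setI_eq0 setIDAC setDIl setDv setI0. Qed.

Definition split_move : builder_move G :=
  BuilderMove matM part_cover part_disjoint.

End SplitMove.

Definition winning_move (G : sgraph) (m : builder_move G) : Prop :=
  forall i, contains (next_graph m i) (complete_graph 3).

Lemma matching0 (G : sgraph) : matching (set0 : {set {set G}}).
Proof. by rewrite /matching sub0set; apply/trivIsetP => A; rewrite inE. Qed.

Lemma forces1P (G : sgraph) : ~ contains G (complete_graph 3) ->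
  forces (complete_graph 3) G 1 <-> exists m : builder_move G, winning_move m.
Proof.
move=> G3; split=> [[s sP]|[m mP]].
  exists (s [::] G) => i; have [[|[|//]] _] := sP (fun=> i); first by move/G3.
  by [].
(* A strategy must answer at every graph; where no winning move exists it plays the empty matching.
   Elsewhere classical choice selects a winning move. *)
pose default (K : sgraph) := split_move (@matching0 K) (sub0set _).
pose s : strategy := fun _ K =>
  if pselect (exists m : builder_move K, winning_move m) is left ex
  then projT1 (cid ex) else default K.
exists s => c; exists 1 => //=; rewrite /s.
case: pselect => [ex|[]]; last by exists m.
exact: (projT2 (cid ex)).
Qed.

(** Forcing within zero rounds amounts to containment in the initial graph, whatever the strategy,
    so the minimum is 1 exactly when 1 works and 0 fails. *)
Lemma forcing_time1P (H G : sgraph) :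
  forcing_time H G = Some 1 <-> forces H G 1 /\ ~ contains G H.
Proof.
have forces0 : contains G H -> forces H G 0.
  by move=> GH; exists (fun _ K => split_move (@matching0 K) (sub0set _)) => c; exists 0.
rewrite /forcing_time; split.
  case: pselect => // ex; case: ex_minnP => k /asboolP kP kmin [k1].
  by rewrite k1 in kP kmin; split=> // /forces0/asboolP/kmin.
move=> [f1 nGH]; case: pselect => [ex|[]]; last by exists 1; apply/asboolP.
case: ex_minnP => [[|[|k]]] /asboolP kP kmin //.
  case: nGH; have [s /(_ (fun=> true))[t]] := kP.
  by rewrite leqn0 => /eqP->.
by have /kmin := asboolT f1.
Qed.

Lemma path_coverP n (M : {set {set 'I_n}}) (a : 'I_n) :
    M \subset path_edges n -> a \in cover M ->
  exists2 b : 'I_n, [set a; b] \in M & b = a.+1 :> nat \/ a = b.+1 :> nat.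
Proof.
move=> /subsetP sM /bigcupP[e eM ae].
have := sM e eM; rewrite inE => /existsP[i /existsP[j /andP[/eqP ij /eqP eij]]].
move: ae eM; rewrite eij !inE => /orP[]/eqP-> eM.
  by exists j => //; left.
by exists i; [rewrite setUC | right].
Qed.

Lemma dpg_path_triangle n (M : {set {set path_graph n}})
    (F : {set {set option 'I_n}}) :
    matching M -> F \subset dpg_edges M ->
    (exists x y z, triangle F x y z) ->
  exists a b : 'I_n, [/\ b = a.+1 :> nat, 0 < a, b.+1 < n,
    [set None; Some a] \in F & [set None; Some b] \in F].
Proof.
move=> /andP[sM _] sF /(dpg_triangle (@path_K3_free n) sF)[a [b]].
wlog ab : a b / (a < b)%N => [wl|] /and3P[Fa Fab Fb].
  have [/wl|ba|/val_inj eab] := ltngtP (a : 'I_n) (b : 'I_n).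
  - by apply; rewrite /triangle Fa Fab Fb.
  - by apply: (wl b a ba); rewrite /triangle Fa Fb setUC Fab.
  have /edge_neq : [set Some a; Some b] \in edges (dpg_step M) := subsetP sF _ Fab.
  by rewrite eab eqxx.
have := subsetP sF _ Fab; rewrite (@dpg_edge_old (path_graph n)) inE path_edgeE.
move=> /andP[abM hab].
have {hab} eba : b = a.+1 :> nat by lia.
have := subsetP sF _ Fa; have := subsetP sF _ Fb.
rewrite !(@dpg_edge_new (path_graph n)).
move=> /(path_coverP sM)[d bd db] /(path_coverP sM)[c ac ca].
(* The edge [[set a; b]] survives the step, so it is not in [M]. Hence the matching edge at [a] goes
   left and the one at [b] goes right. *)
have nbc : c != b by apply: contraNneq abM => <-.
have nad : d != a by apply: contraNneq abM => <-; rewrite setUC.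
exists a, b; split=> //; move: nbc nad (ltn_ord d); rewrite -!val_eqE /=; lia.
Qed.

Lemma path_winning_move_ge6 n (m : builder_move (path_graph n)) :
  winning_move m -> 6 <= n.
Proof.
move=> mP.
have sub i : mv_part m i \subset dpg_edges (mv_matching m).
  rewrite -[dpg_edges _](mv_cover m).
  by case: i; [exact: subsetUr | exact: subsetUl].
have tri i := dpg_path_triangle (mv_matchingP m) (sub i)
  ((contains_K3P (next_graph m i)).1 (mP i)).
have [a [b [eb a0 bn Fa Fb]]] := tri false.
have [c [d [ed c0 dn Fc Fd]]] := tri true.
have neq (x y : 'I_n) : [set None; Some x] \in mv_part m false ->
    [set None; Some y] \in mv_part m true -> x != y.
  move=> Fx Fy; apply: contraTneq Fx => ->.
  by rewrite (disjointFl (mv_disjoint m) Fy).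
(* The parts share no edge at [None], so [a] and [c] differ by at least 2. The smaller is at least
   1, the larger at least 3, and its pair ends at 4 or later with one more vertex to the right. *)
move: (neq _ _ Fa Fc) (neq _ _ Fa Fd) (neq _ _ Fb Fc).
rewrite -!val_eqE /=; lia.
Qed.

Lemma path_ge6_winning_move n :
  6 <= n -> exists m : builder_move (path_graph n), winning_move m.
Proof.
case: n => [|n] // n6; pose v k : path_graph n.+1 := inord k.
have vK k : k < 6 -> v k = k :> nat by move=> k6; rewrite inordK //; lia.
(* The matching 01, 23, 45: vertex [k] lies in the edge of index [k./2], which gives both
   disjointness and coverage. *)
pose M : {set {set path_graph n.+1}} := [set [set v i.*2; v i.*2.+1] | i : 'I_3].
have matM : matching M.
  apply/andP; split.
    apply/subsetP => _ /imsetP[i _ ->] /=; have i3 := ltn_ord i.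
    rewrite path_edgeE !vK; lia.
  apply/trivIsetP => _ _ /imsetP[i _ ->] /imsetP[j _ ->].
  have i3 := ltn_ord i; have j3 := ltn_ord j.
  apply: contraNT => /pred0Pn[x /andP[]] /=; rewrite !inE -!val_eqE /=.
  rewrite !vK; try lia.
  by move=> hi hj; have -> : i = j by apply: val_inj => /=; lia.
have coverM k : k < 6 -> v k \in cover M.
  move=> k6; have k3 : k./2 < 3 by lia.
  apply/bigcupP; exists [set v k./2.*2; v k./2.*2.+1].
    by apply/imsetP; exists (Ordinal k3).
  by rewrite !inE -!val_eqE /= !vK; lia.
(* Only [k] = 1 and [k] = 3 qualify: the path edges 12 and 34 between consecutive matching edges. *)
have pathM k : odd k -> k < 5 -> [set v k; v k.+1] \in path_edges n.+1 :\: M.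
  move=> ok k5; rewrite inE path_edgeE !vK ?eqxx ?andbT; try lia.
  apply/imsetP => -[i _ /setP eki]; have i3 := ltn_ord i.
  have := eki (v k); have := eki (v k.+1).
  by rewrite !inE -!val_eqE /= !vK; lia.
(* Every edge of the triangle on [None], 3, 4 meets 3 or 4, and no edge of the triangle on [None],
   1, 2 does, so [F] separates the two triangles. *)
pose F := [set e in dpg_edges M | (Some (v 3) \in e) || (Some (v 4) \in e)].
have sF : F \subset dpg_edges M by apply/subsetP => e; rewrite inE => /andP[].
exists (split_move matM sF) => i; apply/contains_K3P.
exists None, (Some (v (if i then 3 else 1))), (Some (v (if i then 4 else 2))).
have tri k : odd k -> k < 5 ->
    triangle (dpg_edges M) None (Some (v k)) (Some (v k.+1)).
  move=> ok k5; rewrite /triangle !dpg_edge_new dpg_edge_old pathM //.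
  by rewrite !coverM //; lia.
have sv k l : k < 6 -> l < 6 -> (Some (v k) == Some (v l)) = (k == l).
  by move=> k6 l6; rewrite (inj_eq Some_inj) -val_eqE /= !vK.
by case: i; [have := tri 3 isT isT | have := tri 1 isT isT];
  rewrite /triangle /= !(in_setD, in_set, in_set1, in_set2) /= ?sv //=;
  case/and3P=> -> -> ->.
Qed.

Theorem corollary3p2 (n : nat) :
  forcing_time (complete_graph 3) (path_graph n) = Some 1 <-> 6 <= n.
Proof.
split=> [/forcing_time1P[+ _]|n6].
  by move/(forces1P (@path_K3_free n)) => [m /path_winning_move_ge6].
apply/forcing_time1P; split; last exact: path_K3_free.
exact/(forces1P (@path_K3_free n))/path_ge6_winning_move.
Qed.
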